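(* Let $n\ge 3$. (1) Let a tiling (the tiling of a directed path for $P_n$) be given, with entries $x_i,y_i,z_i$ ($1\le i\le n-1$) nonnegative integers, and impose on the entries $x_i$, $z_i$ the order $x_1\ge z_1\ge x_2\ge z_2\ge\cdots\ge x_{n-1}\ge z_{n-1}$. Let $\lambda=(\lambda_1,\dots,\lambda_n)$ and $\mu=(\mu_1,\dots,\mu_{n-2})$ be the subsequences of $(x_1,z_1,\dots,x_{n-1},z_{n-1})$ consisting of the entries placed on the lines $y=0$ and $y=-1$, respectively. If $x_i\ge y_i\ge z_i$ for each pattern block, i.e. for all $1\le i\le n-1$, then $\mu\sqsubseteq(y_1,\dots,y_{n-1})\sqsubseteq\lambda$, i.e. $\lambda_r\ge y_r\ge\lambda_{r+1}$ for all $1\le r\le n-1$ and $y_s\ge\mu_s\ge y_{s+1}$ for all $1\le s\le n-2$. (2) Conversely, let polynomial dominant weights $\lambda$ of $GL_n$, $(y_1,\dots,y_{n-1})$ of $GL_{n-1}$ and $\mu$ of $GL_{n-2}$ with $\mu\sqsubseteq(y_1,\dots,y_{n-1})\sqsubseteq\lambda$ be given. Place the entries $\lambda_i$, $\mu_j$, $y_k$ at the coordinates $(i,0)$, $(j+1,-1)$, $(k+0.5,-0.5)$, respectively, for all $1\le i\le n$, $1\le j\le n-2$, $1\le k\le n-1$. Then the resulting array is a tiling, defined by a directed path for $P_n$ that connects the $\lambda_i$'s and $\mu_j$'s in weakly decreasing order. That is, if $(x_1,z_1,\dots,x_{n-1},z_{n-1})$ is the rearrangement of the sequence $(\lambda_1,\dots,\lambda_n,\mu_1,\dots,\mu_{n-2})$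 in weakly decreasing order (the entries in the order visited by the path), then for each $1\le i\le n-1$ the entries $x_i,y_i,z_i$ form the $i$th pattern block of the tiling and satisfy $x_i\ge y_i\ge z_i$.
   Context: A polynomial dominant weight of $GL_k$ is a sequence $\alpha\in\mathbb{Z}^k$ with $\alpha_1\ge\cdots\ge\alpha_k\ge 0$. For polynomial dominant weights $\alpha$ of $GL_k$ and $\beta$ of $GL_{k-1}$, $\beta\sqsubseteq\alpha$ (''$\beta$ interlaces $\alpha$'') means $\alpha_1\ge\beta_1\ge\alpha_2\ge\beta_2\ge\cdots\ge\alpha_{k-1}\ge\beta_{k-1}\ge\alpha_k$. Directed paths. Let $P_n=\{(a,b): b=0,\ 1\le a\le n\}\cup\{(a,b): b=-1,\ 2\le a\le n-1\}\subset\mathbb{Z}^2$. A directed path for $P_n$ is a path from $(1,0)$ to $(n,0)$ with $2n-3$ steps visiting each point of $P_n$ exactly once, where each step goes from a point $(a,b)$ to a neighbouring point by moving right to $(a+1,b)$, up to $(a,b+1)$, down to $(a,b-1)$, up-right to $(a+1,b+1)$, or down-right to $(a+1,b-1)$. Such a path has exactly $n-1$ steps that are not up or down, the $i$th one going from column $a=i$ to column $a=i+1$. Each of these is of one of four types: down-right ($\searrow$), harpoon-up ($\rightharpoonup$: a right move on the line $y=0$), harpoon-down ($\rightharpoondown$: a right move on the line $y=-1$), up-right ($\nearrow$). The path is uniquely presented by the sequence of these $n-1$ arrows (the up and down steps being omitted). Pattern blocks and tilings. To the $i$th arrow one attaches the $i$th pattern block, consisting of three entries $x_i,y_i,z_i$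 in the plane: $y_i$ is placed at $(i+0.5,-0.5)$; $x_i$ is placed at $(i,0)$ if the arrow is $\searrow$ or $\rightharpoonup$, and at $(i,-1)$ if it is $\rightharpoondown$ or $\nearrow$; $z_i$ is placed at $(i+1,0)$ if the arrow is $\rightharpoonup$ or $\nearrow$, and at $(i+1,-1)$ if it is $\searrow$ or $\rightharpoondown$. (So $x_i$ is at the starting point and $z_i$ at the end point of the $i$th arrow.) The tiling of a directed path is the concatenation of the pattern blocks, $1\le i\le n-1$, of its sequence of arrows; its entries $x_i,z_i$ occupy each point of $P_n$ exactly once. The phrases ''line $y=0$'' and ''line $y=-1$'' refer to the second coordinate of the plane, not to the entries $y_i$. *)

(* Defs.v *)
From HB Require Import structures.
From mathcomp Require Import all_boot all_order all_algebra.

Set Implicit Arguments.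
Unset Strict Implicit.
Unset Printing Implicit Defensive.

Import Order.TTheory GRing.Theory Num.Theory.
Local Open Scope ring_scope.

(* Sequences are 0-based: the entry alpha_i (i >= 1) is alpha`_i.-1. *)

Definition poly_dominant (k : nat) (alpha : seq int) : Prop :=
  [/\ size alpha = k, sorted >=%R alpha & {in alpha, forall a, 0 <= a}].

Definition interlaces (k : nat) (beta alpha : seq int) : Prop :=
  [/\ poly_dominant k alpha,
      poly_dominant k.-1 beta
    & forall i : nat, (i < k.-1)%N -> alpha`_i.+1 <= beta`_i <= alpha`_i].

Definition point : Type := (int * int)%type.

Definition in_P (n : nat) (q : point) : bool :=
  (q.2 == 0) && (1 <= q.1 <= n%:Z) || (q.2 == -1) && (2 <= q.1 <= n%:Z - 1).

Definition step : rel point := fun u v =>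
  v - u \in [:: (1, 0); (0, 1); (0, -1); (1, 1); (1, -1)].

(* A path is the sequence of the points it visits, one more than its steps. *)
Definition directed_path (n : nat) (p : seq point) : Prop :=
  [/\ size p = (2 * n - 3).+1,
      head 0 p = (1, 0),
      last 0 p = (n%:Z, 0),
      sorted step p
    & forall q : point, in_P n q -> count_mem q p = 1%N].

Inductive arrow : Type := DownRight | HarpoonUp | HarpoonDown | UpRight.

(* None for the omitted up and down steps. *)
Definition step_arrow (u v : point) : option arrow :=
  if v - u == (1, -1) then Some DownRight
  else if v - u == (1, 1) then Some UpRight
  else if v - u == (1, 0) then
    Some (if u.2 == 0 then HarpoonUp else HarpoonDown)
  else None.

Definition path_arrows (p : seq point) : seq arrow :=
  pmap (fun uv => step_arrow uv.1 uv.2) (zip p (behead p)).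

Definition x_point (i : nat) (a : arrow) : point :=
  (i%:Z, if a is (DownRight | HarpoonUp) then 0 else -1).

Definition z_point (i : nat) (a : arrow) : point :=
  (i.+1%:Z, if a is (HarpoonUp | UpRight) then 0 else -1).

Record block : Type :=
  Block { arr : arrow; ent_x : int; ent_y : int; ent_z : int }.

Definition tiling_of (n : nat) (p : seq point) (T : n.-1.-tuple block) : Prop :=
  directed_path n p /\ [seq arr B | B <- T] = path_arrows p.

(* x_1, z_1, ..., x_(n-1), z_(n-1) with the points where they are placed; the
   i-th block is tnth T at the ordinal i - 1. *)
Definition xz_entries (n : nat) (T : n.-1.-tuple block) : seq (point * int) :=
  flatten [seq [:: (x_point i.+1 (arr (tnth T i)), ent_x (tnth T i));
                   (z_point i.+1 (arr (tnth T i)), ent_z (tnth T i))]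
          | i : 'I_n.-1 <- enum 'I_n.-1].

Definition xz_seq (n : nat) (T : n.-1.-tuple block) : seq int :=
  [seq e.2 | e <- xz_entries T].

Definition y_seq (n : nat) (T : n.-1.-tuple block) : seq int :=
  [seq ent_y B | B <- T].

Definition line_seq (n : nat) (T : n.-1.-tuple block) (b : int) : seq int :=
  [seq e.2 | e <- xz_entries T & e.1.2 == b].

Definition nonneg_entries (n : nat) (T : n.-1.-tuple block) : Prop :=
  forall i, [&& 0 <= ent_x (tnth T i), 0 <= ent_y (tnth T i)
             & 0 <= ent_z (tnth T i)].

Definition block_inequalities (n : nat) (T : n.-1.-tuple block) : Prop :=
  forall i, ent_z (tnth T i) <= ent_y (tnth T i) <= ent_x (tnth T i).

(* Arrays of integers in the plane, as lists of (coordinates, entry). Rational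
   coordinates suffice for the points (i + 1/2, -1/2). *)
Definition array : Type := seq ((rat * rat) * int).

Definition y_coord (i : nat) : rat * rat := (i%:R + 1 / 2, - (1 / 2)).

Definition tiling_array (n : nat) (T : n.-1.-tuple block) : array :=
  [seq ((e.1.1%:~R, e.1.2%:~R), e.2) | e <- xz_entries T] ++
  [seq (y_coord i.+1, ent_y (tnth T i)) | i : 'I_n.-1 <- enum 'I_n.-1].

Definition weight_array (n : nat) (lambda y mu : seq int) : array :=
  [seq ((i%:R, 0), lambda`_i.-1) | i <- iota 1 n] ++
  [seq ((j.+1%:R, -1), mu`_j.-1) | j <- iota 1 (n - 2)] ++
  [seq (y_coord k, y`_k.-1) | k <- iota 1 (n - 1)].

(* Main.v *)
Require Import Defs.
From HB Require Import structures.
From mathcomp Require Import all_boot all_order all_algebra.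
From mathcomp Require Import zify.

Set Implicit Arguments.
Unset Strict Implicit.
Unset Printing Implicit Defensive.

Import Order.TTheory GRing.Theory Num.Theory.
Local Open Scope ring_scope.

(** No step of a directed path decreases the column, and columns 1 and n of P_n
have a single point while columns 2, ..., n-1 have two. A path that visits all
of P_n once therefore goes through each inner column by entering it at one of
its two points, moving vertically to the other one and leaving from there. So it
is determined by one bit per inner column c, [e c], saying whether the column is
entered on the upper line, and every choice of bits gives a path
([directed_pathP]). The two points of column c+1 are the end of arrow c and the
start of arrow c+1, and hence carry the entries z_c and x_{c+1}.

(1) The entries lambda_{c+1} and mu_c at the two points of an inner column are
thus z_c and x_{c+1} in some order. Since y_c >= z_c >= x_{c+1} >= y_{c+1}, both
lie between y_{c+1} and y_c, and these are exactly the two interlacing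
conditions; the end columns contribute lambda_1 = x_1 >= y_1 and
lambda_n = z_{n-1} <= y_{n-1}.

(2) Conversely, interlacing places both lambda_{c+1} and mu_c between y_{c+1}
and y_c. Let the path enter column c+1 at the larger of the two entries. Then
z_c is the larger and x_{c+1} the smaller one, so
y_c >= z_c >= x_{c+1} >= y_{c+1}.
The entries decrease along the path, so the path lists them in sorted order.

Both ends are handled like inner columns by the convention [e 1 = false] and
[e n = true]: column 1 is left on the upper line and column n is entered on it.
Throughout, n is written m.+2, so that there are m inner columns, and blocks and
columns are numbered from 1. *)

(** * Interleaving two sequences *)

Definition interleave (S : Type) (f g : nat -> S) (r : seq nat) : seq S :=
  flatten [seq [:: f i; g i] | i <- r].

Lemma map_interleave (S S' : Type) (h : S -> S') (f g : nat -> S) r :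
  map h (interleave f g r) = interleave (h \o f) (h \o g) r.
Proof. by elim: r => //= i r; rewrite /interleave /= => ->. Qed.

Lemma eq_in_interleave (S : Type) (f g f' g' : nat -> S) (r : seq nat) :
  {in r, f =1 f'} -> {in r, g =1 g'} -> interleave f g r = interleave f' g' r.
Proof.
by move=> ef eg; congr flatten; apply/eq_in_map => i ri; rewrite ef ?eg.
Qed.

Lemma interleave_iotaS (S : Type) (f g : nat -> S) j k :
  interleave f g (iota j k.+1) = f j :: g j :: interleave f g (iota j.+1 k).
Proof. by []. Qed.

(** Regroups the sequence from arrow by arrow to column by column: [g (c - 1)]
and [f c] are the end of arrow c-1 and the start of arrow c, both in column c. *)
Lemma interleave_shift (S : Type) (f g : nat -> S) j k :
  interleave f g (iota j k.+1) =
  f j :: rcons (interleave (g \o predn) f (iota j.+1 k)) (g (j + k)%N).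
Proof.
elim: k j => [|k IHk] j; first by rewrite addn0.
by rewrite [LHS]interleave_iotaS IHk [in RHS]interleave_iotaS addSnnS.
Qed.

Lemma sorted_interleave (S : Type) (leT : rel S) (f g : nat -> S) j k :
  sorted leT (interleave f g (iota j k.+1)) =
  all (fun i => leT (f i) (g i)) (iota j k.+1) &&
  all (fun i => leT (g i) (f i.+1)) (iota j k).
Proof.
elim: k j => [|k IHk] j; first by rewrite /= !andbT.
have -> : all (fun i => leT (f i) (g i)) (iota j k.+2) =
  leT (f j) (g j) && all (fun i => leT (f i) (g i)) (iota j.+1 k.+1) by [].
rewrite -[RHS]andbA [all _ (iota j k.+1) as X in _ && (_ && X)]/= [RHS]/=.
have IH := IHk j.+1; rewrite !interleave_iotaS /= in IH *; rewrite IH.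
by case: (leT (g j) _); rewrite ?andbF.
Qed.

Lemma filter_pairs (S : Type) (P : pred S) (f g : nat -> S) r :
  {in r, forall i, P (g i) = ~~ P (f i)} ->
  filter P (interleave f g r) = [seq if P (f i) then f i else g i | i <- r].
Proof.
elim: r => //= i r IHr Pfg; rewrite /interleave /= Pfg ?mem_head //.
have {}IHr := IHr (fun c rc => Pfg c (mem_behead (s := _ :: _) rc)).
by case: (P (f i)) => /=; rewrite -IHr.
Qed.

(** * The two lines of P_n *)

Definition pt (c : nat) (t : bool) : point := (c%:Z, if t then 0 else -1).

(** With these values the formulas for inner columns, where the path enters on
the line given by [e c] and leaves on the other one, also hold at both ends. *)
Definition boundary_bits (m : nat) (e : nat -> bool) : Prop :=
  e 1%N = false /\ e m.+2 = true.

(** Here [f i] and [g i] are attached to the start and the end of arrow i, and P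
selects the upper line. Column c contributes the end of arrow c-1 if it is
entered on that line, and the start of arrow c otherwise. Stated for any type so
as to apply both to points and to points paired with entries. *)
Lemma filter_top (S : Type) (P : pred S) (f g : nat -> S) m e :
  boundary_bits m e ->
  (forall i, P (f i) = ~~ e i) -> (forall i, P (g i) = e i.+1) ->
  filter P (interleave f g (iota 1 m.+1)) =
  [seq if e c then g c.-1 else f c | c <- iota 1 m.+2].
Proof.
move=> [e1 em] Pf Pg; rewrite interleave_shift.
have -> : iota 1 m.+2 = 1%N :: rcons (iota 2 m) m.+2.
  by rewrite -[m.+2]addn1 iotaD cats1 add1n addn1.
rewrite /= Pf e1 /= filter_rcons Pg add1n em map_rcons em /= filter_pairs.
  congr (_ :: rcons _ _); apply/eq_in_map => i; rewrite mem_iota => Hi /=.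
  by rewrite Pg prednK //; lia.
by move=> i; rewrite mem_iota => Hi /=; rewrite Pg Pf prednK //; lia.
Qed.

(** The counterpart of [filter_top] for the lower line, which has no point in
the two end columns. *)
Lemma filter_bottom (S : Type) (P : pred S) (f g : nat -> S) m e :
  boundary_bits m e ->
  (forall i, P (f i) = e i) -> (forall i, P (g i) = ~~ e i.+1) ->
  filter P (interleave f g (iota 1 m.+1)) =
  [seq if e c then f c else g c.-1 | c <- iota 2 m].
Proof.
move=> [e1 em] Pf Pg; rewrite interleave_shift.
rewrite /= Pf e1 /= filter_rcons Pg add1n em /= filter_pairs.
  apply/eq_in_map => i; rewrite mem_iota => Hi /=.
  by rewrite Pg prednK ?if_neg //; lia.
by move=> i; rewrite mem_iota => Hi /=; rewrite Pg Pf prednK ?negbK //; lia.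
Qed.

Lemma perm_lines (S : eqType) (P : pred S) (f g : nat -> S) m e :
  boundary_bits m e ->
  (forall i, P (f i) = ~~ e i) -> (forall i, P (g i) = e i.+1) ->
  perm_eq (interleave f g (iota 1 m.+1))
    ([seq if e c then g c.-1 else f c | c <- iota 1 m.+2] ++
     [seq if e c then f c else g c.-1 | c <- iota 2 m]).
Proof.
move=> He Pf Pg; rewrite perm_sym -(filter_top He Pf Pg).
rewrite -(@filter_bottom _ (predC P) _ _ _ _ He).
- by apply/permPl/perm_filterC.
- by move=> i /=; rewrite Pf negbK.
- by move=> i /=; rewrite Pg.
Qed.

(** * Directed paths are given by their entry bits *)

(** The arguments say whether the arrow starts, respectively ends, on the upper
line. *)
Definition arrow_of (a b : bool) : arrow :=
  match a, b with
  | true, true => HarpoonUp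
  | true, false => DownRight
  | false, false => HarpoonDown
  | false, true => UpRight
  end.

Lemma x_point_arrow_of i a b : x_point i (arrow_of a b) = pt i a.
Proof. by case: a b => [] []. Qed.

Lemma z_point_arrow_of i a b : z_point i (arrow_of a b) = pt i.+1 b.
Proof. by case: a b => [] []. Qed.

Lemma pt_eq c d t u : (pt c t == pt d u) = (c == d) && (t == u).
Proof. by case: t u => [] []; rewrite xpair_eqE eqz_nat ?andbT ?andbF. Qed.

Lemma pt_top c t : ((pt c t).2 == 0) = t. Proof. by case: t. Qed.
Lemma pt_bottom c t : ((pt c t).2 == -1) = ~~ t. Proof. by case: t. Qed.

Lemma pt_subr c d t u : pt c t - pt d u =
  (c%:Z - d%:Z, (if t then 0 else -1) - (if u then 0 else -1)).
Proof. by []. Qed.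

Lemma step_right c a b : step (pt c a) (pt c.+1 b).
Proof.
rewrite /step pt_subr intS addrK.
by case: a b => [] [].
Qed.

Lemma step_vertical c a : step (pt c a) (pt c (~~ a)).
Proof. by rewrite /step pt_subr subrr; case: a. Qed.

Lemma step_arrow_right c a b :
  step_arrow (pt c a) (pt c.+1 b) = Some (arrow_of a b).
Proof. by rewrite /step_arrow pt_subr intS addrK; case: a b => [] []. Qed.

Lemma step_arrow_vertical c a : step_arrow (pt c a) (pt c (~~ a)) = None.
Proof. by rewrite /step_arrow pt_subr subrr; case: a. Qed.

(** The path written as the starts and ends of its arrows; the vertical steps go
from the end of one arrow to the start of the next. *)
Definition zigzag (m : nat) (e : nat -> bool) : seq point :=
  interleave (fun i => pt i (~~ e i)) (fun i => pt i.+1 (e i.+1)) (iota 1 m.+1).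

Lemma zigzag_columns m e : boundary_bits m e ->
  zigzag m e = pt 1 true ::
    rcons (interleave (fun c => pt c (e c)) (fun c => pt c (~~ e c)) (iota 2 m))
          (pt m.+2 true).
Proof.
move=> [e1 em]; rewrite /zigzag interleave_shift e1 add1n em.
congr (_ :: rcons _ _); apply: eq_in_interleave => // c.
rewrite mem_iota => Hc /=; by rewrite prednK //; lia.
Qed.

Lemma sorted_step_zigzag m e : sorted step (zigzag m e).
Proof.
rewrite sorted_interleave; apply/andP; split; apply/allP => i _ /=.
  exact: step_right.
exact: step_vertical.
Qed.

Lemma path_arrows_cons u v s :
  path_arrows (u :: v :: s) =
  oapp (cons^~ (path_arrows (v :: s))) (path_arrows (v :: s)) (step_arrow u v).
Proof. by []. Qed.

Lemma path_arrows_zigzag m e :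
  path_arrows (zigzag m e) =
  [seq arrow_of (~~ e i) (e i.+1) | i <- iota 1 m.+1].
Proof.
rewrite /zigzag; elim: m 1%N => [|m IHm] j.
  by rewrite interleave_iotaS path_arrows_cons step_arrow_right.
rewrite interleave_iotaS path_arrows_cons step_arrow_right.
rewrite interleave_iotaS path_arrows_cons step_arrow_vertical.
exact: (congr1 (cons _) (IHm j.+1)).
Qed.

Definition P_points (m : nat) : seq point :=
  [seq pt c true | c <- iota 1 m.+2] ++ [seq pt c false | c <- iota 2 m].

Lemma perm_zigzag m e : boundary_bits m e -> perm_eq (zigzag m e) (P_points m).
Proof.
move=> He; have := @perm_lines _ (fun q : point => q.2 == 0)
  (fun i => pt i (~~ e i)) (fun i => pt i.+1 (e i.+1)) m e He
  (fun i => pt_top _ _) (fun i => pt_top _ _).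
set L1 := [seq _ | _ <- iota 1 _]; set L2 := [seq _ | _ <- iota 2 _].
suff [-> ->] : L1 = [seq pt c true | c <- iota 1 m.+2] /\
               L2 = [seq pt c false | c <- iota 2 m] by [].
split; apply/eq_in_map => c; rewrite mem_iota => Hc;
  by case ec: (e c); rewrite ?prednK ?ec //; lia.
Qed.

Lemma pt_inj t : injective (pt^~ t).
Proof. by move=> c d /eqP; rewrite pt_eq eqxx andbT => /eqP. Qed.

Lemma uniq_P_points m : uniq (P_points m).
Proof.
rewrite cat_uniq !(map_inj_uniq (@pt_inj _)) !iota_uniq andbT.
apply/hasPn => _ /mapP[c _ ->]; apply/negP => /mapP[d _ /eqP].
by rewrite pt_eq andbF.
Qed.

Lemma size_P_points m : size (P_points m) = (2 * m.+2 - 3).+1.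
Proof. by rewrite size_cat !size_map !size_iota; lia. Qed.

Lemma mem_P_points m q : (q \in P_points m) = in_P m.+2 q.
Proof.
rewrite mem_cat /in_P; case: q => a b.
apply/orP/orP => -[].
- by move=> /mapP[c]; rewrite mem_iota => Hc [-> ->]; left; rewrite /=; lia.
- by move=> /mapP[c]; rewrite mem_iota => Hc [-> ->]; right; rewrite /=; lia.
- move=> /andP[/eqP b0 Ha]; rewrite /= in b0 Ha.
  left; apply/mapP; exists `|a|%N.
    by rewrite mem_iota; lia.
  by rewrite /pt b0; congr pair; lia.
- move=> /andP[/eqP b0 Ha]; rewrite /= in b0 Ha.
  right; apply/mapP; exists `|a|%N.
    by rewrite mem_iota; lia.
  by rewrite /pt b0; congr pair; lia.
Qed.

(** Once the columns visited are known to be j, j, j+1, j+1, ..., the two visits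
to a column must be to its two different points, and only their order is free. *)
Lemma columns_split k j q :
  uniq q -> {in q, forall v : point, (v.2 == 0) || (v.2 == -1)} ->
  map fst q =
    map fst (rcons (interleave (pt^~ true) (pt^~ false) (iota j k))
                   (pt (j + k) true)) ->
  last 0 q = pt (j + k) true ->
  exists e : nat -> bool,
    q = rcons (interleave (fun c => pt c (e c)) (fun c => pt c (~~ e c))
                          (iota j k))
              (pt (j + k) true).
Proof.
have ptP (v : point) c : (v.2 == 0) || (v.2 == -1) -> v.1 = c%:Z ->
    exists t, v = pt c t.
  case: v => a b /= /orP[] /eqP-> ->; first by exists true.
  by exists false.
elim: k j q => [|k IHk] j q.
  case: q => [|u [|v q]] //= _ _ _ ->.
  by exists xpredT.
rewrite interleave_iotaS; case: q => [|u [|v q]] //=.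
rewrite inE negb_or => /andP[/andP[uDv _] /andP[_ uniq_q]] lines [u1 v1 q1].
have [a ua] := ptP u j (lines u (mem_head _ _)) u1.
have [b vb] := ptP v j (lines v (mem_behead (s := _ :: _) (mem_head _ _))) v1.
have {uDv}ba : b = ~~ a.
  by move: uDv; rewrite ua vb pt_eq eqxx; case: a b {ua vb} => [] [].
rewrite -addSnnS in q1 *.
case: q => [|w q] in uniq_q lines q1 *; first by case: (k) q1.
move=> last_q.
have [||e q_e] := IHk j.+1 (w :: q) uniq_q _ q1.
- by move=> p pq; apply: lines; rewrite !inE -in_cons pq !orbT.
- by [].
(* The bits found for the later columns are arbitrary at column j. *)
exists (fun c => if c == j then a else e c); rewrite q_e eqxx ua vb ba.
congr [:: _, _ & rcons _ _]; apply: eq_in_interleave => c;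
  by rewrite mem_iota => Hc; rewrite ifN //; lia.
Qed.

Lemma step_column_le u v : step u v -> u.1 <= v.1.
Proof.
case: u v => [a b] [c d]; rewrite /step.
have -> : (c, d) - (a, b) = (c - a, d - b) :> point by [].
by rewrite !inE !xpair_eqE /=; lia.
Qed.

(** The columns along a path increase weakly and form a fixed multiset, hence a
fixed sequence. *)
Lemma path_columns m e p : boundary_bits m e ->
  perm_eq p (P_points m) -> sorted step p -> map fst p = map fst (zigzag m e).
Proof.
move=> He perm_p step_p.
have le_columns q : sorted step q -> sorted <=%R (map fst q).
  by rewrite sorted_map; apply: sub_sorted => u v; apply: step_column_le.
apply: (sorted_eq le_trans le_anti); [exact: le_columns| |].
  exact/le_columns/sorted_step_zigzag.
by apply/perm_map/(perm_trans perm_p); rewrite perm_sym perm_zigzag.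
Qed.

(** A path has as many points as P_n, so visiting each point of P_n once leaves
no room for points outside P_n. *)
Lemma directed_pathP m p :
  directed_path m.+2 p <-> exists2 e, boundary_bits m e & p = zigzag m e.
Proof.
split=> [[sz_p hd_p last_p step_p P_p]|[e He ->]]; last first.
  have perm_e := perm_zigzag He.
  split.
  - by rewrite (perm_size perm_e) size_P_points.
  - by rewrite zigzag_columns.
  - by rewrite zigzag_columns //= last_rcons.
  - exact: sorted_step_zigzag.
  - move=> q Pq; rewrite (permP perm_e) count_uniq_mem ?uniq_P_points //.
    by rewrite mem_P_points Pq.
have uniq_P := uniq_P_points m.
have sub_P : {subset P_points m <= p}.
  by move=> q; rewrite mem_P_points -has_pred1 has_count => /P_p->.
have le_p : (size p <= size (P_points m))%N by rewrite size_P_points sz_p.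
have perm_p : perm_eq p (P_points m).
  rewrite perm_sym uniq_perm //; first exact: leq_size_uniq sub_P le_p.
  by have [] := uniq_min_size uniq_P sub_P le_p.
(* Any zigzag serves to name the sequence of columns; this one enters every
   column from above. *)
pose e1 c := c != 1%N.
have He1 : boundary_bits m e1 by [].
have := path_columns He1 perm_p step_p; rewrite zigzag_columns //.
have lines_p : {in p, forall v : point, (v.2 == 0) || (v.2 == -1)}.
  move=> v; rewrite (perm_mem perm_p) mem_P_points /in_P.
  by case/orP => /andP[-> _]; rewrite ?orbT.
have := perm_uniq perm_p; rewrite uniq_P.
case: p {sz_p step_p P_p sub_P le_p perm_p}
  => [//|u q] in hd_p last_p lines_p *.
move: hd_p => /= -> /andP[_ uniq_q] [cols_q].
have [|||e q_e] := @columns_split m 2 q uniq_q.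
- by move=> v qv; apply: lines_p; rewrite inE qv orbT.
- rewrite cols_q !map_rcons !map_interleave; congr rcons.
- have := congr1 size cols_q; rewrite !size_map size_rcons.
  by case: (q) last_p.
exists (fun c => (c != 1%N) && ((c == m.+2) || e c)).
  by split; rewrite //= eqxx.
rewrite zigzag_columns; last by split; rewrite //= eqxx.
rewrite q_e; congr (_ :: rcons _ _).
by apply: eq_in_interleave => c; rewrite mem_iota => Hc /=;
  have -> : c != 1%N by [lia]; have -> : (c == m.+2) = false by lia.
Qed.

(** * Tilings in terms of entry bits *)

Lemma map_enum_ord_succ (S : Type) (F : nat -> S) k :
  [seq F i.+1 | i : 'I_k <- enum 'I_k] = [seq F i | i <- iota 1 k].
Proof. by rewrite (iotaDl 1 0) -val_enum_ord -!map_comp. Qed.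

Lemma tiling_ofP m p (T : m.+2.-1.-tuple block) :
  tiling_of p T <-> exists e, [/\ boundary_bits m e, p = zigzag m e &
    forall i, arr (tnth T i) = arrow_of (~~ e i.+1) (e i.+2)].
Proof.
have arrE e : [seq arr B | B <- T] = path_arrows (zigzag m e) <->
    forall i, arr (tnth T i) = arrow_of (~~ e i.+1) (e i.+2).
  rewrite path_arrows_zigzag.
  rewrite -(map_enum_ord_succ (fun i => arrow_of (~~ e i) (e i.+1))).
  rewrite -{1}(map_tnth_enum T) -map_comp; split=> [/eq_in_map H i|H].
    by apply: H; rewrite mem_enum.
  by apply: eq_map.
split=> [[/directed_pathP[e He ->] /arrE HT]|[e [He -> HT]]].
  by exists e.
by split; [apply/directed_pathP; exists e|apply/arrE].
Qed.

Lemma xz_entriesE m (T : m.+2.-1.-tuple block) (e : nat -> bool)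
    (x z : nat -> int) :
  (forall i : 'I_m.+1, arr (tnth T i) = arrow_of (~~ e i.+1) (e i.+2)) ->
  (forall i : 'I_m.+1, ent_x (tnth T i) = x i.+1) ->
  (forall i : 'I_m.+1, ent_z (tnth T i) = z i.+1) ->
  xz_entries T = interleave (fun i => (pt i (~~ e i), x i))
                          (fun i => (pt i.+1 (e i.+1), z i)) (iota 1 m.+1).
Proof.
move=> HT Hx Hz; congr flatten.
rewrite -(map_enum_ord_succ (fun i => [:: (pt i (~~ e i), x i);
                                         (pt i.+1 (e i.+1), z i)])).
by apply: eq_map => i; rewrite HT Hx Hz x_point_arrow_of z_point_arrow_of.
Qed.

(** * From tilings to interlacing weights *)

Lemma sorted_separated (s t : seq int) :
  (forall i, (i.+1 < size s)%N -> s`_i.+1 <= t`_i <= s`_i) -> sorted >=%R s.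
Proof.
move=> st; apply/(sortedP 0) => i /st /andP[h1 h2].
exact: le_trans h1 h2.
Qed.

(** Every pair y_c, y_{c+1} encloses both entries of column c+1, because these
are z_c and x_{c+1}. *)
Lemma tiling_interlaces m p (T : m.+2.-1.-tuple block) :
  tiling_of p T -> nonneg_entries T ->
  sorted >=%R (xz_seq T) -> block_inequalities T ->
  interlaces m.+1 (line_seq T (-1)) (y_seq T) /\
  interlaces m.+2 (y_seq T) (line_seq T 0).
Proof.
move=> /tiling_ofP[e [He _ HT]] T_ge0.
pose B i := tnth T (inord i.-1).
have BE (i : 'I_m.+1) : B i.+1 = tnth T i by rewrite /B /= inord_val.
pose x i := ent_x (B i); pose z i := ent_z (B i); pose y i := ent_y (B i).
have xzE : xz_entries T = _ :=
  @xz_entriesE m T e x z HT (fun i => congr1 ent_x (esym (BE i)))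
    (fun i => congr1 ent_z (esym (BE i))).
have yE : y_seq T = [seq y i | i <- iota 1 m.+1].
  rewrite /y_seq -{1}(map_tnth_enum T) -map_comp -map_enum_ord_succ.
  by apply: eq_map => i; rewrite /= /y BE.
have topE : line_seq T 0 =
    [seq if e c then z c.-1 else x c | c <- iota 1 m.+2].
  rewrite /line_seq xzE (filter_top He) => [|i|i]; rewrite ?pt_top //.
  by rewrite -map_comp; apply: eq_map => c /=; case: (e c).
have bottomE : line_seq T (-1) =
    [seq if e c then x c else z c.-1 | c <- iota 2 m].
  rewrite /line_seq xzE (filter_bottom He) => [|i|i];
    rewrite ?pt_bottom ?negbK //.
  by rewrite -map_comp; apply: eq_map => c /=; case: (e c).
have ge0 i : [&& 0 <= x i, 0 <= y i & 0 <= z i] by exact: T_ge0.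
rewrite /xz_seq xzE map_interleave sorted_interleave => /andP[_ /allP zx].
move=> T_ineq; have yx i : y i <= x i by have /andP[] := T_ineq (inord i.-1).
have zy i : z i <= y i by have /andP[] := T_ineq (inord i.-1).
have {}zx i : (0 < i <= m)%N -> x i.+1 <= z i.
  by move=> Hi; apply: zx; rewrite mem_iota; lia.
case: He => e1 em.
have top_y i : (i < m.+1)%N -> (line_seq T 0)`_i.+1
    <= (y_seq T)`_i <= (line_seq T 0)`_i.
  move=> Hi; rewrite topE yE !(nth_map 0%N) ?size_iota ?nth_iota //; try lia.
  rewrite !add1n /=; apply/andP; split.
    case: ifP => [_|ei]; first exact: zy.
    apply: le_trans (zy _); apply: zx.
    by have : i <> m by [move=> im; rewrite im em in ei]; lia.
  case: ifP => [ei|_]; last exact: yx.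
  case: i Hi ei => [|i] Hi ei; first by rewrite e1 in ei.
  by apply: le_trans (yx _) _; apply: zx; lia.
have y_bottom i : (i < m)%N -> (y_seq T)`_i.+1
    <= (line_seq T (-1))`_i <= (y_seq T)`_i.
  move=> Hi; rewrite bottomE yE !(nth_map 0%N) ?size_iota ?nth_iota //; try lia.
  rewrite !add1n !add2n /=; have {}zx := zx i.+1 Hi.
  have := yx i.+2; have := zy i.+1.
  by case: ifP => _; lia.
have y_size : size (y_seq T) = m.+1 by rewrite yE size_map size_iota.
have dom_y : poly_dominant m.+1 (y_seq T).
  split=> //.
  - by apply: sorted_separated => i; rewrite y_size; apply: y_bottom.
  - by rewrite yE => _ /mapP[i _ ->]; have /and3P[] := ge0 i.
do 2!split=> //; split.
- by rewrite bottomE size_map size_iota.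
- apply: (@sorted_separated _ (behead (y_seq T))) => i.
  rewrite bottomE size_map size_iota -bottomE nth_behead => Hi.
  have /andP[_ ->] := y_bottom i.+1 Hi.
  by have /andP[-> _] := y_bottom i (ltnW Hi).
- rewrite bottomE => _ /mapP[c _ ->].
  by case: ifP => _; [have /and3P[] := ge0 c | have /and3P[] := ge0 c.-1].
- by rewrite topE size_map size_iota.
- apply: (@sorted_separated _ (y_seq T)) => i.
  by rewrite topE size_map size_iota -topE; apply: top_y.
- rewrite topE => _ /mapP[c _ ->].
  by case: ifP => _; [have /and3P[] := ge0 c.-1 | have /and3P[] := ge0 c].
Qed.

(** * From interlacing weights to tilings *)

(** Enters each inner column at its larger entry. Ties are broken towards the
upper line. *)
Lemma interlaces_tiling m (lambda y mu : seq int) :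
  interlaces m.+1 mu y -> interlaces m.+2 y lambda ->
  exists (p : seq point) (T : m.+2.-1.-tuple block),
    [/\ tiling_of p T,
        perm_eq (tiling_array T) (weight_array m.+2 lambda y mu),
        [seq e.1 | e <- xz_entries T] = p,
        xz_seq T = sort >=%R (lambda ++ mu)
      & block_inequalities T].
Proof.
move=> [_ [size_mu _ _] /= y_mu] [[size_l _ _] _ /= l_y].
(* Column c carries lambda_c = lambda`_(c-1) and, if it is an inner column,
   mu_(c-1) = mu`_(c-2). *)
pose e c := (c != 1%N) && ((c == m.+2) || (mu`_(c - 2) <= lambda`_c.-1)).
have He : boundary_bits m e by split; rewrite // /e eqxx.
pose x c := if e c then mu`_(c - 2) else lambda`_c.-1.
pose z c := if e c.+1 then lambda`_c else mu`_c.-1.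
pose T : m.+2.-1.-tuple block :=
  [tuple Block (arrow_of (~~ e i.+1) (e i.+2)) (x i.+1) y`_i (z i.+1)
  | i < m.+1].
have HT (i : 'I_m.+1) : arr (tnth T i) = arrow_of (~~ e i.+1) (e i.+2).
  by rewrite tnth_mktuple.
have xzE : xz_entries T = _ := @xz_entriesE m T e x z HT
  (fun i => congr1 ent_x (tnth_mktuple _ i))
  (fun i => congr1 ent_z (tnth_mktuple _ i)).
have topE c : (0 < c)%N -> (if e c then z c.-1 else x c) = lambda`_c.-1.
  by move=> c_gt0; rewrite /z /x prednK //; case: (e c).
have bottomE c : (1 < c)%N -> (if e c then x c else z c.-1) = mu`_(c - 2).
  by move=> c_gt1; rewrite /z /x prednK ?subn2; [case: (e c)|lia].
have perm_xz : perm_eq (xz_entries T)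
    ([seq (pt c true, lambda`_c.-1) | c <- iota 1 m.+2] ++
     [seq (pt c false, mu`_(c - 2)) | c <- iota 2 m]).
  rewrite xzE.
  apply: perm_trans (perm_lines (P := fun v => v.1.2 == 0) He _ _) _.
  - by move=> i; rewrite pt_top.
  - by move=> i; rewrite pt_top.
  set L1 := [seq _ | _ <- iota 1 _]; set L2 := [seq _ | _ <- iota 2 _].
  have -> : L1 = [seq (pt c true, lambda`_c.-1) | c <- iota 1 m.+2].
    apply/eq_in_map => c; rewrite mem_iota => /andP[c_gt0 _].
    by rewrite -topE //; case ec: (e c); rewrite /= ?prednK ?ec.
  have -> // : L2 = [seq (pt c false, mu`_(c - 2)) | c <- iota 2 m].
  apply/eq_in_map => c; rewrite mem_iota => /andP[c_gt1 _].
  by rewrite -bottomE //; case ec: (e c); rewrite /= ?prednK ?ec //; lia.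
have ineq i : (i < m.+1)%N -> z i.+1 <= y`_i <= x i.+1.
  move=> Hi; have /andP[zl lx] := l_y i Hi; apply/andP; split.
    (* If block i.+1 ends on the lower line, it ends in an inner column. *)
    rewrite /z; case: ifP => //= /negbT; rewrite /e /= negb_or => /andP[i_m _].
    by have /andP[] : y`_i.+1 <= mu`_i <= y`_i by apply: y_mu; lia.
  (* If it starts on the lower line, it starts in an inner column. *)
  rewrite /x; case: ifP => //=; rewrite /e /= => /andP[i_0 _].
  have := y_mu (i.+1 - 2)%N; have -> : ((i.+1 - 2).+1 = i)%N by lia.
  by move=> /(_ _)/andP[]//; lia.
have zx i : (0 < i <= m)%N -> x i.+1 <= z i.
  move=> Hi; rewrite /x /z /e /= (_ : (i.+1 == m.+2) = false) /=; last lia.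
  rewrite (_ : i.+1 != 1%N) /=; last lia.
  rewrite (_ : i.+1 - 2 = i.-1)%N; last lia.
  by case: (leP mu`_i.-1 lambda`_i) => // /ltW.
have xz_val : xz_seq T = interleave x z (iota 1 m.+1).
  by rewrite /xz_seq xzE map_interleave.
have eq_perm (S : eqType) (s t : seq S) : s = t -> perm_eq s t by move=> ->.
exists (zigzag m e), T; split.
- by apply/tiling_ofP; exists e.
- rewrite /tiling_array /weight_array catA perm_cat //.
    apply: perm_trans (perm_map _ perm_xz) _; rewrite map_cat -!map_comp subn2.
    rewrite [iota 2 m](iotaDl 1 1) -map_comp; apply: eq_perm.
    congr (_ ++ _); apply: eq_map => c /=; rewrite -pmulrn //.
    by rewrite add1n subSS subn1.
  rewrite -(map_enum_ord_succ (fun k => (y_coord k, y`_k.-1))).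
  by apply/eq_perm/eq_map => i; rewrite tnth_mktuple.
- by rewrite xzE map_interleave.
- apply: (sorted_eq (leT := >=%R)).
  + by move=> a b c /= ab bc; apply: le_trans bc ab.
  + by move=> a b /= ab; apply/le_anti; rewrite andbC.
  + rewrite xz_val sorted_interleave; apply/andP; split; apply/allP => i.
      rewrite mem_iota => Hi; have := ineq i.-1; rewrite prednK; last lia.
      by move=> /(_ _)/andP[]; [lia|apply: le_trans].
    by rewrite mem_iota => Hi; apply: zx; lia.
  + by apply: sort_sorted => a b; apply: le_total.
  apply: perm_trans (perm_map snd perm_xz) _.
  rewrite perm_sym perm_sort perm_sym map_cat -!map_comp.
  rewrite [iota 2 m](iotaDl 2 0) [iota 1 _](iotaDl 1 0) -!map_comp.
  rewrite -[in X in perm_eq _ X](mkseq_nth 0 lambda).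
  rewrite -[in X in perm_eq _ X](mkseq_nth 0 mu).
  rewrite size_l size_mu; apply: eq_perm; congr (_ ++ _).
  by apply: eq_map => i; rewrite /= add2n subn2.
- by move=> i; rewrite tnth_mktuple; apply: ineq.
Qed.

Theorem proposition4p3 (n : nat) (hn : (3 <= n)%N) :
  (forall (p : seq point) (T : n.-1.-tuple block),
     tiling_of p T ->
     nonneg_entries T ->
     sorted >=%R (xz_seq T) ->
     block_inequalities T ->
     interlaces n.-1 (line_seq T (-1)) (y_seq T) /\
     interlaces n (y_seq T) (line_seq T 0))
  /\
  (forall lambda y mu : seq int,
     interlaces n.-1 mu y ->
     interlaces n y lambda ->
     exists (p : seq point) (T : n.-1.-tuple block),
       [/\ tiling_of p T,
           perm_eq (tiling_array T) (weight_array n lambda y mu),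
           [seq e.1 | e <- xz_entries T] = p,
           xz_seq T = sort >=%R (lambda ++ mu)
         & block_inequalities T]).
Proof.
case: n hn => [|[|m]] // _; split; first exact: tiling_interlaces.
exact: interlaces_tiling.
Qed.
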